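(* Let $n\ge3$, $N=n(n-1)/2$, and $$\Lambda=\{(x,y)\in[0,1]\times[0,1] : 0\le y\le x\le 1,\ 0<1-(x+y)y\le x\le 1\}.$$ Then $$\bigcap_{(\lambda_1,\lambda_2)\in\Lambda}C_{\lambda_1,\lambda_2}=\{\mathcal{R} : \mathcal{R}_{\alpha\alpha}\ge0,\ \forall\,1\le\alpha\le N\},$$ $$\bigcup_{(\lambda_1,\lambda_2)\in\Lambda}C_{\lambda_1,\lambda_2}=\{\mathcal{R} : \mathcal{R}_{\alpha\alpha}+\mathcal{R}_{\beta\beta}\ge0,\ \forall\,1\le\alpha<\beta\le N\},$$ and $$\bigcup_{(\lambda_1,\lambda_2)\in\Lambda}C^+_{\lambda_1,\lambda_2}=\{\mathcal{R} : \mathcal{R}_{\alpha\alpha}+\mathcal{R}_{\beta\beta}>0,\ \forall\,1\le\alpha<\beta\le N\}.$$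
   Context: Here $\mathcal{R}$ ranges over curvature operators, regarded as self-adjoint endomorphisms (equivalently, symmetric bilinear forms) of the $N$-dimensional inner product space $\Lambda^2T_xM^n\cong so(n)$. For such $\mathcal{R}$, let $\{\omega_\alpha\}_{\alpha=1}^N$ be an orthonormal basis of eigenvectors with eigenvalues $\mu_1\le\mu_2\le\cdots\le\mu_N$, and write $\mathcal{R}_{\alpha\alpha}=\mathcal{R}(\omega_\alpha,\omega_\alpha)=\mu_\alpha$. For $(\lambda_1,\lambda_2)\in\Lambda$, $C_{\lambda_1,\lambda_2}$ is the set of $\mathcal{R}$ such that $$\mathcal{R}_{\alpha\alpha}+\lambda_1\mathcal{R}_{\beta\beta}+\lambda_2\mathcal{R}_{\gamma\gamma}\ge0\quad\text{for all }1\le\alpha<\beta<\gamma\le N$$ and $$\lambda_1\mathcal{R}_{\alpha\alpha}+\bigl(1-(\lambda_1+\lambda_2)\lambda_2\bigr)\mathcal{R}_{\beta\beta}\ge0\quad\text{for all }1\le\alpha<\beta\le N.$$ $C^+_{\lambda_1,\lambda_2}$ is defined in the same way with $\ge$ replaced by $>$ in both conditions. *)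

(* Defs.v *)
From HB Require Import structures.
From mathcomp Require Import all_boot all_order all_algebra.
From mathcomp Require Import all_classical all_reals.

Set Implicit Arguments.
Unset Strict Implicit.
Unset Printing Implicit Defensive.
Import Order.TTheory GRing.Theory Num.Theory.
Local Open Scope classical_set_scope.
Local Open Scope ring_scope.

(* The tangent space is R^n, and Lambda^2 R^n is so(n), with
   e_i /\ e_j = E_ij - E_ji. *)
Definition skewmx (R : realType) (n : nat) : {vspace 'M[R]_n} :=
  lker (linfun (trmx : 'M[R]_n -> 'M[R]_n) + \1)%VF.

Lemma skewmxP (R : realType) (n : nat) (A : 'M[R]_n) :
  (A \in skewmx R n) = (A^T == - A).
Proof. by rewrite memv_ker add_lfunE lfunE id_lfunE addr_eq0. Qed.

Notation so R n := (subvs_of (skewmx R n)).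

Definition wedge (R : realType) (n : nat) (i j : 'I_n) : so R n :=
  vsproj (skewmx R n) (delta_mx i j - delta_mx j i).

Lemma wedgeE (R : realType) (n : nat) (i j : 'I_n) :
  vsval (wedge R i j) = delta_mx i j - delta_mx j i.
Proof.
by rewrite vsprojK // skewmxP linearB /= !trmx_delta opprB.
Qed.

(* Normalized so that the e_i /\ e_j with i < j are orthonormal. *)
Definition so_dot (R : realType) (n : nat) (A B : so R n) : R :=
  2^-1 * \tr ((vsval A)^T *m vsval B).

Definition so_dim (n : nat) : nat := (n * n.-1)./2.

Definition ltpairs (n : nat) : seq ('I_n * 'I_n) :=
  enum [pred x : 'I_n * 'I_n | (x.1 < x.2)%N].

Lemma size_ltpairs n : size (ltpairs n) = so_dim n.
Proof.
rewrite -cardE -[RHS]bin2 -bin2_sum big_mkord -sum1_card.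
rewrite -(pair_big_dep xpredT (fun i j : 'I_n => (i < j)%N) (fun _ _ => 1%N)) /=.
rewrite (exchange_big_dep xpredT) //=; apply: eq_bigr => i _.
rewrite sum1_card -[RHS]card_ord.
have le_in : (i <= n)%N by exact: ltnW.
rewrite -(card_imset _ (f := widen_ord le_in)); last by move=> x y /(congr1 val) /= h; apply: val_inj.
apply: eq_card => x; rewrite !unfold_in /=; apply/idP/imsetP.
- by move=> h; exists (Ordinal h) => //; apply: val_inj.
- by case=> y _ ->; exact: (ltn_ord y).
Qed.

Lemma dim_so (R : realType) n : \dim {: so R n} = so_dim n.
Proof.
pose w (x : 'I_n * 'I_n) : so R n := wedge R x.1 x.2.
have wE x i j : vsval (w x) i j = ((i, j) == x)%:R - ((j, i) == x)%:R.
  by case: x => k l; rewrite wedgeE !mxE /= !xpair_eqE [(j == _) && _]andbC.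
have vZ (c : R) (B : so R n) i j : vsval (c *: B) i j = c * vsval B i j.
  by have -> : vsval (c *: B) = c *: vsval B by []; rewrite mxE.
have sumE (c : 'I_n * 'I_n -> R) (i j : 'I_n) : (i < j)%N ->
    vsval (\sum_(x <- ltpairs n) c x *: w x) i j = c (i, j).
  move=> ij; rewrite linear_sum summxE (bigD1_seq (i, j)) ?enum_uniq ?mem_enum //=.
  rewrite vZ wE eqxx big_seq_cond big1 ?addr0 => [|x].
    by rewrite xpair_eqE [j == i]eq_sym -val_eqE ltn_eqF //= subr0 mulr1.
  rewrite mem_enum inE => /andP[xlt xne]; rewrite vZ wE eq_sym (negPf xne).
  case: eqP => [xe|]; last by rewrite subrr mulr0.
  by move: xlt; rewrite -xe /= ltnNge ltnW.
have wspan (A : so R n) : A = \sum_(x <- ltpairs n) vsval A x.1 x.2 *: w x.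
  apply: val_inj; apply/matrixP => i j.
  have sk (B : so R n) i' j' : vsval B j' i' = - vsval B i' j'.
    by have := subvsP B; rewrite skewmxP => /eqP/matrixP/(_ i' j'); rewrite !mxE.
  have [ij|ji|/val_inj ->] := ltngtP i j.
  - by rewrite sumE.
  - by rewrite sk [RHS]sk sumE.
  - have z (B : so R n) : vsval B j j = 0.
      by have /eqP := sk B j j; rewrite -addr_eq0 -mulr2n mulrn_eq0 => /eqP.
    by rewrite !z.
pose X := [seq w x | x <- ltpairs n].
have Xfull : <<X>>%VS = fullv.
  apply/eqP; rewrite eqEsubv subvf; apply/subvP => A _.
  rewrite (wspan A) big_seq memv_suml // => x xl; apply/memvZ/memv_span/map_f/xl.
suff Xfree : free X by rewrite -size_ltpairs -(size_map w) -/X -(eqP Xfree) Xfull.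
rewrite -[X]/(val (in_tuple X)); apply/freeP => k /= k0 i.
have il : (i < size (ltpairs n))%N by rewrite -(size_map w).
have [p0 _] : exists p0 : 'I_n * 'I_n, true.
  by case: (ltpairs n) il => // p; exists p.
pose p (j : 'I_(size X)) := nth p0 (ltpairs n) j.
have lp j : (j < size (ltpairs n))%N -> ((nth p0 (ltpairs n) j).1 < (nth p0 (ltpairs n) j).2)%N.
  by move=> /(mem_nth p0); rewrite mem_enum.
have := congr1 (fun B : so R n => vsval B (p i).1 (p i).2) k0.
rewrite linear0 mxE linear_sum summxE (bigD1 i) //= big1 ?addr0 => [|j ji].
  rewrite vZ (nth_map p0) // wE -surjective_pairing eqxx /p.
  move: (lp _ il); case: (nth _ _ _) => a b /= ab.
  by rewrite xpair_eqE [b == a]eq_sym -val_eqE ltn_eqF //= subr0 mulr1.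
have jl : (j < size (ltpairs n))%N by rewrite -(size_map w).
rewrite vZ (nth_map p0) // wE -surjective_pairing /p.
rewrite nth_uniq ?enum_uniq // val_eqE eq_sym (negPf ji).
case: eqP => [xe|]; last by rewrite subrr mulr0.
by have := lp _ jl; rewrite -xe /= ltnNge ltnW // lp.
Qed.

Definition selfadjoint_operators (R : realType) (n : nat) :
    set 'End(so R n) :=
  [set T | forall A B, so_dot (T A) B = so_dot A (T B)].

Definition bianchi (R : realType) (n : nat) (T : 'End(so R n)) : Prop :=
  let Rm i j k l := so_dot (T (wedge R i j)) (wedge R k l) in
  forall i j k l, Rm i j k l + Rm j k i l + Rm k i j l = 0.

Definition curvature_operators (R : realType) (n : nat) : set 'End(so R n) :=
  [set T | selfadjoint_operators T /\ bianchi T].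

Definition eigenframe (R : realType) (n : nat) (T : 'End(so R n))
    (w : (so_dim n).-tuple (so R n)) : Prop :=
  [/\ basis_of fullv w,
      forall a b, so_dot (tnth w a) (tnth w b) = (a == b)%:R &
      exists2 mu : 'I_(so_dim n) -> R,
        forall a, T (tnth w a) = mu a *: tnth w a &
        forall a b : 'I_(so_dim n), (a <= b)%N -> mu a <= mu b].

(* T_aa = T(w_a, w_a), the a-th eigenvalue when w is an eigenframe of T. *)
Definition diag_entry (R : realType) (n : nat) (T : 'End(so R n))
    (w : (so_dim n).-tuple (so R n)) (a : 'I_(so_dim n)) : R :=
  so_dot (T (tnth w a)) (tnth w a).

(* The members of K whose ordered eigenvalues, counted with multiplicity,
   satisfy P.  A self-adjoint T has an eigenframe, and all its eigenframes
   give the same diagonal entries, so the choice of w is immaterial. *)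
Definition spectral_set (R : realType) (n : nat) (K : set 'End(so R n))
    (P : ('I_(so_dim n) -> R) -> Prop) : set 'End(so R n) :=
  [set T | K T /\ exists2 w, eigenframe T w & P (diag_entry T w)].

Definition Lambda (R : realType) : set (R * R) :=
  [set l | [/\ 0 <= l.1 <= 1, 0 <= l.2 <= 1, 0 <= l.2 <= l.1 &
               0 < 1 - (l.1 + l.2) * l.2 <= l.1]].

Definition cone (R : realType) (n : nat) (K : set 'End(so R n)) (l : R * R) :
    set 'End(so R n) :=
  spectral_set K (fun r =>
    (forall a b c : 'I_(so_dim n), (a < b < c)%N ->
       0 <= r a + l.1 * r b + l.2 * r c) /\
    (forall a b : 'I_(so_dim n), (a < b)%N ->
       0 <= l.1 * r a + (1 - (l.1 + l.2) * l.2) * r b)).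

Definition open_cone (R : realType) (n : nat) (K : set 'End(so R n))
    (l : R * R) : set 'End(so R n) :=
  spectral_set K (fun r =>
    (forall a b c : 'I_(so_dim n), (a < b < c)%N ->
       0 < r a + l.1 * r b + l.2 * r c) /\
    (forall a b : 'I_(so_dim n), (a < b)%N ->
       0 < l.1 * r a + (1 - (l.1 + l.2) * l.2) * r b)).

Arguments selfadjoint_operators R n : clear implicits.
Arguments curvature_operators R n : clear implicits.
Arguments Lambda R : clear implicits.

(* Main.v *)
Require Import Defs.
From HB Require Import structures.
From mathcomp Require Import all_boot all_order all_algebra.
From mathcomp Require Import all_classical all_reals.
From mathcomp Require Import ring lra.
Import Order.TTheory GRing.Theory Num.Theory.
Local Open Scope classical_set_scope.
Local Open Scope ring_scope.

(** Both unions are attained at the single parameter [(1, 0)], where the cone is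
    2-nonnegativity; conversely the second cone inequality
    [l1 r_a + z r_b >= 0] with [0 < z <= l1] and [r_a <= r_b] forces
    [r_b >= 0], whence [l1 (r_a + r_b) >= 0].  For the intersection, [l1 = 1]
    and [l2] tending to the golden ratio conjugate make [z] an arbitrarily
    small [e > 0], so that [r_a + e r_b >= 0] gives [r_a >= 0].  The eigenframe
    may vary with the parameter, but any two eigenframes have the same set of
    eigenvalues, which is enough to pass to the limit. *)

Lemma diag_entry_eigen {R : realType} {n : nat} {T : 'End(so R n)}
    {w : (so_dim n).-tuple (so R n)} {mu : 'I_(so_dim n) -> R} :
  (forall a b, so_dot (tnth w a) (tnth w b) = (a == b)%:R) ->
  (forall a, T (tnth w a) = mu a *: tnth w a) ->
  forall a, diag_entry T w a = mu a.
Proof.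
move=> orth Tw a; rewrite /diag_entry Tw /so_dot.
have -> : vsval (mu a *: tnth w a) = mu a *: vsval (tnth w a) by [].
rewrite linearZ -scalemxAl mxtraceZ mulrCA.
by have := orth a a; rewrite /so_dot eqxx => ->; rewrite mulr1.
Qed.

Lemma eigenframe_diag_homo {R : realType} {n : nat} {T : 'End(so R n)}
    {w : (so_dim n).-tuple (so R n)} :
  eigenframe T w ->
  forall a b : 'I_(so_dim n), (a <= b)%N -> diag_entry T w a <= diag_entry T w b.
Proof.
by case=> _ orth [mu Tw mu_homo] a b ab; rewrite !(diag_entry_eigen orth Tw) mu_homo.
Qed.

(** Since [w'] is a basis, [tnth w a] has a nonzero coordinate along some [tnth w' b]. Comparing the
    [b]-th coordinates of [T (tnth w a)], computed in both frames, and cancelling that coordinate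
    gives [mu a = mu' b]. *)
Lemma eigenframe_spectrum {R : realType} {n : nat} {T : 'End(so R n)}
    {w w' : (so_dim n).-tuple (so R n)} :
  eigenframe T w -> eigenframe T w' ->
  forall a, exists b, diag_entry T w a = diag_entry T w' b.
Proof.
case=> wb orth [mu Tw _] [wb' orth' [mu' Tw' _]] a.
have v0 : tnth w a != 0.
  by move: (basis_free wb) => /free_not0; apply; exact: mem_tnth.
have [b cb0] : exists b, coord w' b (tnth w a) != 0.
  apply/existsP; apply: contraNT v0; rewrite negb_exists => /forallP c0.
  rewrite (coord_basis wb' (memvf (tnth w a))) big1 // => i _.
  by have := c0 i; rewrite negbK => /eqP ->; rewrite scale0r.
exists b; rewrite (diag_entry_eigen orth Tw) (diag_entry_eigen orth' Tw').
apply: (mulIf cb0); have := congr1 (coord w' b) (Tw a).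
rewrite linearZ /= => <-.
rewrite {1}(coord_basis wb' (memvf (tnth w a))) linear_sum.
under eq_bigr => i _ do rewrite linearZ /= -tnth_nth Tw' scalerA [tnth w' i](tnth_nth 0).
by rewrite coord_sum_free ?(basis_free wb') // mulrC.
Qed.

(** The same eigenframe serves both sides, which reduces inclusions to inequalities on nondecreasing
    sequences. *)
Lemma spectral_set_sub {R : realType} {n : nat} (K : set 'End(so R n))
    (P Q : ('I_(so_dim n) -> R) -> Prop) :
  (forall r, (forall a b : 'I_(so_dim n), (a <= b)%N -> r a <= r b) -> P r -> Q r) ->
  spectral_set K P `<=` spectral_set K Q.
Proof.
move=> PQ T [KT [w Tw Pw]]; split=> //; exists w => //.
by apply: PQ Pw; exact: eigenframe_diag_homo.
Qed.

Lemma Lambda10 (R : realType) : Lambda R (1, 0).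
Proof. by split=> /=; lra. Qed.

(* [y] is the positive root of [y^2 + y = 1 - e]. *)
Lemma Lambda_golden (R : realType) (e : R) : 0 < e <= 1 ->
  exists2 y, Lambda R (1, y) & 1 - (1 + y) * y = e.
Proof.
(* [5 - 4 * e] is the discriminant of [y^2 + y - (1 - e)]; the bounds [1 <= s <= 3] below amount to
   [0 <= y <= 1]. *)
move=> /andP[e0 e1]; pose s := Num.sqrt (5 - 4 * e).
have s2 : s ^+ 2 = 5 - 4 * e by rewrite sqr_sqrtr //; lra.
have s0 : 0 <= s by exact: sqrtr_ge0.
have ye : 1 - (1 + (s - 1) / 2) * ((s - 1) / 2) = e.
  have -> : e = (5 - s ^+ 2) / 4 by rewrite s2; field.
  by field.
have s1 : 1 <= s by nra.
have s3 : s <= 3 by nra.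
exists ((s - 1) / 2) => //; split=> /=; rewrite ?ye; lra.
Qed.

Lemma so_dim_gt1 n : (3 <= n)%N -> (1 < so_dim n)%N.
Proof.
case: n => [|[|[|n]]] // _; rewrite /so_dim.
have : (3 * 2 <= n.+3 * n.+2)%N by rewrite leq_mul.
by move/half_leq; apply: leq_trans.
Qed.

Theorem theorem2p2 (R : realType) (n : nat) (hn : (3 <= n)%N)
    (K : set 'End(so R n))
    (hK : K = curvature_operators R n \/ K = selfadjoint_operators R n) :
  [/\ \bigcap_(l in Lambda R) cone K l =
        spectral_set K (fun r => forall a : 'I_(so_dim n), 0 <= r a),
      \bigcup_(l in Lambda R) cone K l =
        spectral_set K (fun r => forall a b : 'I_(so_dim n), (a < b)%N ->
          0 <= r a + r b) &
      \bigcup_(l in Lambda R) open_cone K l =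
        spectral_set K (fun r => forall a b : 'I_(so_dim n), (a < b)%N ->
          0 < r a + r b)].
Proof.
clear hK; split; apply/seteqP; split.
- move=> T TC; have [KT [w Tw _]] := TC _ (Lambda10 R).
  split=> //; exists w => // a; rewrite leNgt; apply/negP => ra0.
  have N1 := so_dim_gt1 _ hn.
  pose o : 'I_(so_dim n) := Ordinal (ltnW N1).
  have Np : ((so_dim n).-1 < so_dim n)%N by rewrite prednK // ltnW.
  pose m : 'I_(so_dim n) := Ordinal Np.
  have om : (o < m)%N by rewrite /= -ltnS prednK // ltnW.
  have lem (b : 'I_(so_dim n)) : (b <= m)%N by rewrite /= -ltnS prednK // ltnW.
  set ra := diag_entry T w a in ra0; set M := diag_entry T w m.
  have M0 : 0 <= `|M| := normr_ge0 M.
  have d0 : 0 < `|M| - ra by lra.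
  (* This [e] is small enough that [ra + e * |M| = - ra^2 / (|M| - ra)] is negative. *)
  have e01 : 0 < - ra / (`|M| - ra) <= 1.
    by rewrite divr_gt0 ?ler_pdivrMr //=; lra.
  have [y yL ye] := Lambda_golden _ _ e01.
  have [_ [w' Tw' [_ /(_ o m om)]]] := TC _ yL.
  rewrite /= ye mul1r => pos.
  (* Matching eigenvalues bounds the extreme entries of [w'] by quantities independent of [y]: the
     lowest is at most [ra], the highest at most [M]. *)
  have [c rac] := eigenframe_spectrum Tw Tw' a.
  have [d rmd] := eigenframe_spectrum Tw' Tw m.
  have oc := eigenframe_diag_homo Tw' o c isT.
  have dm := eigenframe_diag_homo Tw d m (lem d).
  have r'M : diag_entry T w' m <= `|M|.
    by rewrite rmd; apply: le_trans dm (ler_norm _).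
  have {}pos : 0 <= ra + - ra / (`|M| - ra) * `|M|.
    apply: le_trans pos _; rewrite lerD //; first by rewrite /ra rac.
    by rewrite ler_wpM2l //; case/andP: e01 => /ltW.
  have := mulr_ge0 pos (ltW d0).
  rewrite mulrDl [_ * `|M| * _]mulrAC divfK ?gt_eqF //.
  by nra.
- move=> T TP [x y] /= [/= /andP[x0 _] /andP[y0 _] _ /andP[z0 _]].
  apply: spectral_set_sub TP => r _ r0 /=; split=> [a b c _|a b _].
    by rewrite !addr_ge0 ?mulr_ge0.
  by rewrite addr_ge0 ?mulr_ge0 // ltW.
- move=> T [[x y] /= [/= _ _ _ /andP[z0 zx]]].
  move: zx z0; set z := 1 - _ => zx z0.
  apply: spectral_set_sub => r rh [_ r0] a b ab.
  have rab := rh a b (ltnW ab); have {r0} /= := r0 a b ab.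
  rewrite -/z => r0.
  (* Otherwise [r a <= r b < 0], and [x * r a + z * r b] would be negative. *)
  have rb0 : 0 <= r b by rewrite leNgt; apply/negP => ?; nra.
  by rewrite -(pmulr_rge0 _ (lt_le_trans z0 zx)); nra.
- move=> T TP; exists (1, 0); first exact: Lambda10.
  apply: spectral_set_sub TP => r _ r0 /=.
  split=> [a b c /andP[ab _]|a b ab]; have := r0 a b ab; lra.
- move=> T [[x y] /= [/= _ _ _ /andP[z0 zx]]].
  move: zx z0; set z := 1 - _ => zx z0.
  apply: spectral_set_sub => r rh [_ r0] a b ab.
  have rab := rh a b (ltnW ab); have {r0} /= := r0 a b ab.
  rewrite -/z => r0.
  have rb0 : 0 <= r b by rewrite leNgt; apply/negP => ?; nra.
  (* [x * (r a + r b)] exceeds the positive [x * r a + z * r b] by [(x - z) * r b >= 0], so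
     strictness survives even when [r b = 0]. *)
  by rewrite -(pmulr_rgt0 _ (lt_le_trans z0 zx)); nra.
- move=> T TP; exists (1, 0); first exact: Lambda10.
  apply: spectral_set_sub TP => r _ r0 /=.
  split=> [a b c /andP[ab _]|a b ab]; have := r0 a b ab; lra.
Qed.
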